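(* As $n\to+\infty$, $\kappa_+(n)\leqslant 2n\log n\,(1+o(1))$; that is, there is a function $\varepsilon(n)\to0$ such that $\kappa_+(n)\le 2n\log n\,(1+\varepsilon(n))$ for all $n\ge2$.
   Context: Every integer $n\ge 1$ is assigned a finite rooted planar tree $t(n)$: $t(1)$ is the single-vertex tree; if $n=p_1^{a_1}\cdots p_s^{a_s}$ with primes $p_1<\dots<p_s$ and $a_i\ge1$, then $t(n)$ consists of a root with $s$ edges to children, ordered left to right, the $i$-th edge leading to a copy of $t(a_i)$ rooted at that child. For $n\ge1$, $K\ge0$, the observable $O(n,\ldots,n+K)$ occurs at $m\ge1$ if $t(m+j)=t(n+j)$ for all $0\le j\le K$. $\kappa_+(n)$ is the least natural number $K$ such that $O(n,n+1,\ldots,n+K)$ occurs only at $m=n$ (well defined for all $n$). *)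

(* Defs.v *)
From mathcomp Require Import all_boot zify boolp.

Set Implicit Arguments.
Unset Strict Implicit.
Unset Printing Implicit Defensive.

Inductive planar_tree : Type := Node of seq planar_tree.

(* logn p n < n for n > 0, so fuel n suffices; tree_ofE is the recursion that
   characterizes tree_of. The value at n = 0 is meaningless. *)
Fixpoint tree_of_rec (fuel n : nat) : planar_tree :=
  if fuel is fuel'.+1
  then Node [seq tree_of_rec fuel' (logn p n) | p <- primes n]
  else Node [::].

Definition tree_of (n : nat) : planar_tree := tree_of_rec n n.

Lemma tree_of_rec_fuel (k l n : nat) :
  n <= k -> n <= l -> tree_of_rec k n = tree_of_rec l n.
Proof.
elim: k l n => [|k IHk] [|l] [|n] //= nk nl; congr Node; apply: eq_map => p.
by apply: IHk; rewrite -ltnS; apply: leq_trans (ltn_logl p (ltn0Sn n)) _.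
Qed.

(* primes n lists the prime divisors of n in increasing order. *)
Lemma tree_ofE (n : nat) :
  tree_of n = Node [seq tree_of (logn p n) | p <- primes n].
Proof.
case: n => // n; rewrite {1}/tree_of /=; congr Node; apply: eq_map => p.
by apply: tree_of_rec_fuel; rewrite // -ltnS ltn_logl.
Qed.

Definition occurs_at (n K m : nat) : Prop :=
  forall j : nat, j <= K -> tree_of (m + j) = tree_of (n + j).

Definition occurs_only_at_itself (n K : nat) : Prop :=
  forall m : nat, 0 < m -> occurs_at n K m -> m = n.

(* The observable of n occurs only at n as soon as K is large: the number of
   prime factors summed over a long window grows when the window moves far to
   the right, which bounds m, and distinct m, n are eventually separated since
   m |-> size (primes m) is not eventually periodic. *)
Lemma tree_of_omega (m n : nat) :
  tree_of m = tree_of n -> size (primes m) = size (primes n).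
Proof.
by rewrite tree_ofE [tree_of n]tree_ofE => -[] /(congr1 size); rewrite !size_map.
Qed.

Lemma prod_ge_exp (c : nat) (s : seq nat) (F : nat -> nat) :
  {in s, forall p, c <= F p} -> c ^ size s <= \prod_(p <- s) F p.
Proof.
elim: s => [|a s IHs] H; first by rewrite big_nil.
rewrite big_cons /= expnS leq_mul ?H ?mem_head// IHs// => p ps.
by apply: H; rewrite inE ps orbT.
Qed.

Lemma prod_le_exp (c : nat) (s : seq nat) (F : nat -> nat) :
  {in s, forall p, F p <= c} -> \prod_(p <- s) F p <= c ^ size s.
Proof.
elim: s => [|a s IHs] H; first by rewrite big_nil.
rewrite big_cons /= expnS leq_mul ?H ?mem_head// IHs// => p ps.
by apply: H; rewrite inE ps orbT.
Qed.

Lemma omega_le (s x : nat) : x < 2 ^ s.+1 -> size (primes x) <= s.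
Proof.
case: (posnP x) => [->//|x0]; apply: contraTT; rewrite -leqNgt -ltnNge => lt_s.
apply: leq_trans (_ : 2 ^ size (primes x) <= _); first by rewrite leq_exp2l.
rewrite [x in _ <= x]prod_prime_decomp // prime_decompE big_map /=.
apply: prod_ge_exp => p px.
have := px; rewrite mem_primes => /and3P[pp _ _].
apply: leq_trans (prime_gt1 pp) _.
by rewrite -{1}(expn1 p) leq_exp2l ?prime_gt1// logn_gt0.
Qed.

Lemma count_primes (L x : nat) : 0 < x ->
  count (gtn L) (primes x) = \sum_(p < L | prime p) (p %| x).
Proof.
move=> x0; rewrite -big_mkcondr /= sum1_card -size_filter.
rewrite cardE -(size_map val); apply: perm_size; apply: uniq_perm.
- by rewrite filter_uniq ?primes_uniq.
- by rewrite map_inj_uniq ?enum_uniq//; exact: val_inj.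
move=> p; rewrite mem_filter mem_primes x0 /=; apply/idP/mapP.
  move=> /and3P[pL pp px]; exists (Ordinal pL) => //.
  by rewrite mem_enum unfold_in /= pp px.
by move=> [q]; rewrite mem_enum unfold_in /= => /andP[pq qx] ->; rewrite ltn_ord pq.
Qed.

Lemma count_multiples (p m L : nat) : 0 < p ->
  \sum_(j < L) (p %| m.+1 + j) + m %/ p = (m + L) %/ p.
Proof.
move=> p0; elim: L => [|L IHL]; first by rewrite big_ord0 addn0.
by rewrite big_ord_recr /= addnAC IHL addSn addnS divnS// addnC.
Qed.

Lemma count_multiples_le (p m L : nat) : 0 < p ->
  \sum_(j < L) (p %| 1 + j) <= \sum_(j < L) (p %| m.+1 + j).
Proof.
move=> p0; rewrite -(leq_add2r (m %/ p)) (count_multiples m L p0).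
have := count_multiples 0 L p0; rewrite div0n addn0 => ->.
by rewrite add0n [leqLHS]addnC divnD ?leq_addr.
Qed.

Lemma card_primes_le (k : nat) : \sum_(p < k.*2) prime p <= k.
Proof.
case: k => [|[|k]]; rewrite ?big_ord0//; first by rewrite !big_ord_recr big_ord0.
elim: k => [|k IHk]; first by rewrite !big_ord_recr big_ord0.
have ev : prime k.+2.*2 = false.
  by apply/negP => /even_prime[]; rewrite ?odd_double; lia.
rewrite doubleS; move: IHk ev; move: k.+2.*2 => q IHk ev.
rewrite !big_ord_recr /= ev addn0.
by apply: leq_trans (leq_add IHk (leq_b1 _)) _; rewrite addn1.
Qed.

(* In a window of length L far enough to the right, the numbers all of whose
   prime factors are below L are at most as many as the primes below L: each
   has a prime power divisor exceeding L, and no two share the prime. *)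
Lemma card_smooth_le (L m : nat) : L ^ L < m ->
  #|[pred j : 'I_L | all (gtn L) (primes (m + j))]| <= \sum_(p < L) prime p.
Proof.
move=> mL; have m0 : 0 < m by exact: leq_ltn_trans mL.
have ex (j : 'I_L) : all (gtn L) (primes (m + j)) ->
    exists p : 'I_L, prime p && (L < p ^ logn p (m + j)).
  move=> /allP sm; apply: contrapT => no.
  have x0 : 0 < m + j by rewrite addn_gt0 m0.
  have : m + j <= L ^ L.
    rewrite [m + j]prod_prime_decomp // prime_decompE big_map /=.
    apply: leq_trans (_ : L ^ size (primes (m + j)) <= _).
      apply: prod_le_exp => p px; rewrite leqNgt; apply/negP => pL.
      apply: no; exists (Ordinal (sm _ px)) => /=.
      by move: px; rewrite pL andbT mem_primes => /andP[].
    have L0 : 0 < L by case: (j) => i; case: (L).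
    rewrite leq_pexp2l// -[leqRHS](size_iota 0).
    apply: uniq_leq_size; first exact: primes_uniq.
    by move=> p /sm; rewrite mem_iota.
  by apply/negP; rewrite -ltnNge (leq_trans mL)// leq_addr.
rewrite -big_mkcond /= sum1_card.
pose g (j : 'I_L) := odflt j [pick p : 'I_L | prime p && (L < p ^ logn p (m + j))].
have gP (j : 'I_L) : all (gtn L) (primes (m + j)) ->
    prime (g j) && (L < g j ^ logn (g j) (m + j)).
  move=> /ex [p pP]; rewrite /g; case: pickP => //= /(_ p).
  by rewrite pP.
rewrite -(@card_in_image _ _ g [pred j : 'I_L | all (gtn L) (primes (m + j))]);
  last first.
  have key (i j : 'I_L) : i <= j -> all (gtn L) (primes (m + i)) ->
      all (gtn L) (primes (m + j)) -> g i = g j -> i = j.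
    move=> ij /gP/andP[pi iL] /gP/andP[_ jL] gij.
    move: jL; rewrite -gij; set p := g i in pi iL * => jL.
    pose e := minn (logn p (m + i)) (logn p (m + j)).
    have eL : L < p ^ e by rewrite /e /minn; case: ifP.
    have di : p ^ e %| m + i.
      by rewrite pfactor_dvdn ?addn_gt0 ?m0// geq_minl.
    have dj : p ^ e %| m + j.
      by rewrite pfactor_dvdn ?addn_gt0 ?m0// geq_minr.
    have := dvdn_sub dj di; rewrite subnDl => /dvdn_leq.
    case: (posnP (j - i)) => [ji0 _|ji0 /(_ isT)].
      by apply/val_inj/eqP; rewrite eqn_leq ij -subn_eq0 ji0.
    move=> /(leq_trans eL); have := ltn_ord j; lia.
  move=> i j; rewrite !unfold_in /= => si sj gij; case: (leqP i j) => ij.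
    exact: key.
  by apply/esym; apply: key => //; rewrite ltnW.
apply/subset_leq_card/fintype.subsetP => p /imageP[j].
by rewrite !unfold_in /= => /gP/andP[pj _] ->.
Qed.

Lemma sum_omega_ge (k m : nat) : k.*2 ^ k.*2 < m ->
  \sum_(j < k.*2) size (primes j) + k <= \sum_(j < k.*2) size (primes (m + j)).
Proof.
set L := k.*2 => mL.
have m0 : 0 < m by exact: leq_ltn_trans mL.
have low : \sum_(j < L) size (primes j) <=
    \sum_(j < L) count (gtn L) (primes (m + j)).
  apply: leq_trans (_ : \sum_(j < L) \sum_(p < L | prime p) (p %| 1 + j) <= _).
    case: (L) => [|l]; first by rewrite big_ord0.
    rewrite big_ord_recl add0n big_ord_recr /= -[leqLHS]addn0.
    rewrite leq_add// leq_sum// => j _.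
    rewrite -count_primes// -size_filter (_ : filter _ _ = primes j.+1)//.
    apply/all_filterP/allP => p; rewrite mem_primes => /and3P[_ _ /dvdn_leq].
    by move=> /(_ isT) /leq_ltn_trans; apply; rewrite ltnS ltn_ord.
  under [leqRHS]eq_bigr => j _ do rewrite count_primes ?addn_gt0 ?m0//.
  rewrite exchange_big [leqRHS]exchange_big leq_sum// => p pp.
  by rewrite -(prednK m0) count_multiples_le ?prime_gt0.
have high : k <= \sum_(j < L) count (predC (gtn L)) (primes (m + j)).
  apply: leq_trans (_ : \sum_(j < L) ~~ all (gtn L) (primes (m + j)) <= _).
    have := card_smooth_le mL; rewrite -sum1_card.
    rewrite (big_mkcond (fun j : 'I_L => j \in _)) /=.
    set A := \sum_(i < L) _ => AL.
    have AB : A + \sum_(j < L) ~~ all (gtn L) (primes (m + j)) = L.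
      rewrite -[RHS]card_ord -sum1_card -big_split /=; apply: eq_bigr => i _.
      by rewrite inE; case: all.
    rewrite -(leq_add2l A) AB /L -addnn leq_add2r.
    exact: leq_trans AL (card_primes_le k).
  by apply: leq_sum => j _; rewrite -has_predC has_count; case: count.
apply: leq_trans (leq_add low high) _; rewrite -big_split /=.
by apply: leq_sum => j _; rewrite count_predC.
Qed.

Lemma occurs_at_bounded (n : nat) :
  exists K M, forall m, 0 < m -> occurs_at n K m -> m <= M.
Proof.
pose s := n.*2 + 5; pose k := 2 ^ s.-1.
have Lk : k.*2 = 2 ^ s by rewrite /k /s -mul2n -expnS; congr (_ ^ _); lia.
have n2 : n < 2 ^ n by exact: ltn_expl.
have nk : n * s < k.
  have -> : k = 16 * (2 ^ n * 2 ^ n).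
    by rewrite /k -expnD (_ : 16 = 2 ^ 4)// -expnD; congr (_ ^ _); rewrite /s; lia.
  by rewrite /s; nia.
have nL : n <= k.*2.
  by rewrite Lk (leq_trans (ltnW n2))// leq_exp2l// /s; lia.
exists k.*2, (k.*2 ^ k.*2) => m m0 occ; rewrite leqNgt; apply/negP => big_m.
have lo := sum_omega_ge big_m.
have up : \sum_(j < k.*2) size (primes (m + j)) <=
    \sum_(j < k.*2) size (primes j) + \sum_(i < n) size (primes (k.*2 + i)).
  under eq_bigr => j _ do rewrite (tree_of_omega (occ j (ltnW (ltn_ord j)))).
  apply: leq_trans (_ : \sum_(j < k.*2 + n) size (primes j) <= _).
    by rewrite addnC big_split_ord leq_addl.
  by rewrite big_split_ord.
have small : \sum_(i < n) size (primes (k.*2 + i)) <= n * s.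
  rewrite -[n in n * s]card_ord -sum_nat_const; apply: leq_sum => i _.
  by apply: omega_le; rewrite expnS -Lk; have := ltn_ord i; lia.
have := leq_trans lo up; rewrite leq_add2l => /leq_trans/(_ small).
by rewrite leqNgt nk.
Qed.

Lemma occurs_at_separated (m n : nat) :
  m != n -> exists j, tree_of (m + j) <> tree_of (n + j).
Proof.
wlog lt_mn : m n / m < n => [H|_].
  rewrite neq_ltn => /orP[lt_mn|lt_nm]; first by apply: H; rewrite ?ltn_eqF.
  have [|j nj] := H n m lt_nm; first by rewrite ltn_eqF.
  by exists j => tj; apply: nj; rewrite tj.
apply: contrapT => no; pose d := n - m; have d0 : 0 < d by rewrite subn_gt0.
have per x : m <= x -> size (primes (x + d)) = size (primes x).
  move=> mx; apply: esym; apply: tree_of_omega; apply: contrapT => nx; apply: no; exists (x - m).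
  by rewrite subnKC//; move=> e; apply: nx; rewrite e /d; congr (tree_of _); lia.
have const i : size (primes (d * (m.+1 + i))) = size (primes (d * m.+1)).
  elim: i => [|i IHi]; first by rewrite addn0.
  rewrite addnS mulnS addnC per ?IHi//; nia.
have [p lt_p pp] := prime_above (d * m.+1).
have x0 : 0 < d * m.+1 by rewrite muln_gt0 d0.
have : p \notin primes (d * m.+1).
  by apply/negP; rewrite mem_primes => /and3P[_ _ /dvdn_leq]; lia.
have [i ei] : exists i, m.+1 * p = m.+1 + i.
  by exists (m.+1 * p - m.+1); rewrite subnKC// leq_pmulr// prime_gt0.
have := const i; rewrite -ei mulnA => e pN.
have : size (p :: primes (d * m.+1)) <= size (primes (d * m.+1 * p)).
  apply: uniq_leq_size; first by rewrite /= pN primes_uniq.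
  move=> q; rewrite inE => /orP q_in; rewrite primesM ?(prime_gt0 pp)//.
  by case: q_in => [/eqP->|->//]; rewrite (primes_prime pp) inE eqxx orbT.
by rewrite e /= ltnn.
Qed.

Lemma kappa_plus_exists (n : nat) : exists K, `[< occurs_only_at_itself n K >].
Proof.
have [K0 [M bound]] := occurs_at_bounded n.
have sep m : exists j, m != n -> tree_of (m + j) <> tree_of (n + j).
  by case: (eqVneq m n) => [_|/occurs_at_separated [j ?]]; [exists 0|exists j].
have [J JP] := choice sep.
exists (maxn K0 (\max_(m < M.+1) J m)); apply/asboolP => m m0 occ.
have mM : m < M.+1.
  by rewrite ltnS; apply: bound => // j jK; apply: occ; rewrite leq_max jK.
apply/eqP/contraT => /JP; apply: contra_notT => _; apply: occ.
by rewrite leq_max (leq_bigmax (Ordinal mM)) orbT.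
Qed.

Definition kappa_plus (n : nat) : nat := ex_minn (kappa_plus_exists n).

(* Main.v *)
(* If the observable also occurs at m <> n, then tree_of has a period on a long
   interval starting at n, hence a period D >= L on a window [n, n + L).
   Comparing the sums of the number of prime factors over [n, n + L) and
   [n + D, n + D + L), every prime of the first window is carried to a prime of
   the second one that is too large to divide anything in the first.  Hence the
   number of primes in [n, n + L) is at most prime_pi n plus the number of pairs
   (p, x) with p > n prime, p dividing x and L < x <= L + n.  By Chebyshev's
   bounds, averaging over L = i * n with i of order log n shows that for some i
   these pairs are only o(n) many, whereas [n, n + L) contains at least c * n
   primes.  This gives kappa_plus n <= n * log2 n for large n, which is below
   2 * n * ln n. *)
From Pilot Require Import Defs.
From mathcomp Require Import all_boot all_order all_algebra.
From mathcomp Require Import all_classical all_reals all_analysis.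
From mathcomp Require Import zify lra.
(* Imported again because mathcomp.analysis.cantor exports another tree_of. *)
Import Pilot.Defs.

Set Implicit Arguments.
Unset Strict Implicit.
Unset Printing Implicit Defensive.

(** * Primes in an interval and the prime-counting function *)

Definition primes_in (m n : nat) : seq nat :=
  [seq p <- index_iota m n | prime p].

Definition prime_pi (x : nat) : nat := size (primes_in 0 x.+1).

Lemma mem_primes_in (m n p : nat) :
  (p \in primes_in m n) = prime p && (m <= p < n).
Proof. by rewrite mem_filter mem_index_iota. Qed.

Lemma primes_in_uniq (m n : nat) : uniq (primes_in m n).
Proof. by rewrite filter_uniq ?iota_uniq. Qed.

Lemma primes_in_cat (m n k : nat) : m <= n -> n <= k ->
  primes_in m k = primes_in m n ++ primes_in n k.
Proof.
move=> mn nk; rewrite -filter_cat /index_iota -{2}(subnKC mn) -iotaD.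
by congr (seq.filter _ (iota _ _)); lia.
Qed.

Lemma prime_piD (x y : nat) : x <= y ->
  prime_pi y = prime_pi x + size (primes_in x.+1 y.+1).
Proof. by move=> xy; rewrite -size_cat -primes_in_cat. Qed.

Lemma leq_prime_pi (x y : nat) : x <= y -> prime_pi x <= prime_pi y.
Proof. by move=> /prime_piD ->; apply: leq_addr. Qed.

(** * Chebyshev's bounds from the central binomial coefficient *)

Lemma prod_primes_dvd (s : seq nat) (N : nat) : uniq s ->
  {in s, forall p, prime p && (p %| N)} -> \prod_(p <- s) p %| N.
Proof.
elim: s => [|p s IHs] /=; first by rewrite big_nil dvd1n.
move=> /andP[ps us] H; rewrite big_cons Gauss_dvd.
  have /andP[_ ->] := H p (mem_head _ _); apply: IHs => // q qs.
  by apply: H; rewrite inE qs orbT.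
have /andP[pp _] := H p (mem_head _ _).
rewrite big_seq; elim/big_ind: _ => [|x y|q qs]; first exact: coprimen1.
  by rewrite coprimeMr => -> ->.
have /andP[pq _] : prime q && (q %| N) by apply: H; rewrite inE qs orbT.
by rewrite prime_coprime // dvdn_prime2 //; apply: contraNneq ps => ->.
Qed.

Lemma central_bin_le (y : nat) : 'C(y.*2, y) <= 2 ^ y.*2.
Proof.
rewrite -[2]/(1 + 1) expnDn (bigD1 (inord y)) //= inordK; last by lia.
by rewrite !exp1n !muln1 leq_addr.
Qed.

(** Pascal's rule and symmetry give C(2y+2, y+1) = 2 C(2y+1, y) >= 2 C(2y, y). *)
Lemma central_bin_ge (y : nat) : 2 ^ y <= 'C(y.*2, y).
Proof.
elim: y => [|y IHy] //.
rewrite doubleS binS expnS.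
have := bin_sub (_ : y <= y.*2.+1); rewrite (_ : y.*2.+1 - y = y.+1); last by lia.
move=> -> //; last by lia.
rewrite addnn -mul2n leq_mul2l /=; apply: leq_trans IHy _.
by case: y => // y; rewrite [in leqRHS]binS leq_addr.
Qed.

Lemma prime_ndvd_fact (p y : nat) : prime p -> y < p -> ~~ (p %| y`!).
Proof.
move=> pp; elim: y => [|y IHy] yp; first by rewrite dvdn1; case: p pp yp => [|[]].
rewrite factS Euclid_dvdM // negb_or IHy ?andbT; last exact: ltnW.
by apply/negP => /dvdn_leq; lia.
Qed.

(** The product of the primes in (y, 2y] divides C(2y, y) <= 2^(2y), and each of them exceeds y >=
    2^([trunc_log 2 y]). *)
Lemma primes_in_double_le (y : nat) : 0 < y ->
  size (primes_in y.+1 y.*2.+1) * trunc_log 2 y <= y.*2.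
Proof.
move=> y0; set s := primes_in _ _.
have le1 : \prod_(p <- s) p <= 'C(y.*2, y).
  apply: dvdn_leq; first by rewrite bin_gt0; lia.
  apply: prod_primes_dvd => [|p]; first exact: primes_in_uniq.
  rewrite mem_primes_in => /and3P[pp yp p2y]; rewrite pp /=.
  have : p %| y.*2`! by rewrite dvdn_fact // prime_gt0.
  rewrite -(@bin_fact _ y); last by lia.
  rewrite (_ : y.*2 - y = y); last by lia.
  by rewrite !Euclid_dvdM // (negPf (prime_ndvd_fact pp yp)) !orbF.
have le2 : y ^ size s <= \prod_(p <- s) p.
  by apply: prod_ge_exp => p; rewrite mem_primes_in; lia.
rewrite -(@leq_exp2l 2) // mulnC expnM.
apply: leq_trans (leq_trans le1 (central_bin_le y)).
by apply: leq_trans le2; case: (size s) => // c; rewrite leq_exp2r ?trunc_logP.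
Qed.

(** Dyadic induction starting at k = 2. A constant c survives the step from k to k + 1 if (c + 2)(k
    + 1) <= 2 c k; at k = 2 this means c >= 6, and larger k ask for less. *)
Lemma prime_pi_exp2_le (k : nat) : k * prime_pi (2 ^ k) <= 6 * 2 ^ k.
Proof.
case: k => [//|[//|k]]; elim: k => [//|k IHk].
have := @primes_in_double_le (2 ^ k.+2); rewrite expn_gt0 trunc_expnK // => /(_ isT).
rewrite (@prime_piD (2 ^ k.+2) (2 ^ k.+3)); last by rewrite leq_exp2l.
have -> : (2 ^ k.+2).*2 = 2 ^ k.+3 by rewrite [RHS]expnS mul2n.
move: IHk; rewrite [2 ^ k.+3]expnS.
set A := prime_pi _; set B := size (primes_in _ _); move: A B (2 ^ k.+2) => A B C; nia.
Qed.

(** By Legendre's formula the exponent is the sum over k of floor(2y / p^k) - 2 floor(y / p^k); each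
    term is at most 1 and vanishes once p^k > 2y. *)
Lemma logn_central_bin (p y : nat) : prime p -> 0 < y ->
  p ^ logn p 'C(y.*2, y) <= y.*2.
Proof.
move=> pp y0; have p1 := prime_gt1 pp.
have e : logn p 'C(y.*2, y) + (logn p y`!).*2 = logn p y.*2`!.
  rewrite -(@bin_fact y.*2 y); last by lia.
  rewrite (_ : y.*2 - y = y); last by lia.
  by rewrite !lognM ?muln_gt0 ?fact_gt0 ?bin_gt0 ?addnn //; lia.
apply: leq_trans (trunc_logP p1 (_ : 0 < y.*2)); last by lia.
rewrite leq_exp2l //; move: e; rewrite !logn_fact //.
set t := trunc_log p y.*2.
have ty : t <= y.*2.
  by apply: leq_trans (ltnW (ltn_expl t p1)) _; apply: trunc_logP; lia.
have z k : t < k -> y.*2 %/ p ^ k = 0.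
  move=> tk; apply: divn_small; apply: leq_trans (trunc_log_ltn y.*2 p1) _.
  by rewrite leq_exp2l.
rewrite (@big_cat_nat _ _ _ t.+1 1 y.*2.+1) //= [X in _ = _ + X]big_nat_cond.
rewrite [X in _ = _ + X]big1 => [|k /andP[/andP[tk _] _]]; last exact: z.
(* Terms with k > t or k > y are zero, so this sum too may run up to t, whichever of t and y is
   larger. *)
have -> : \sum_(1 <= k < y.+1) y %/ p ^ k = \sum_(1 <= k < t.+1) y %/ p ^ k.
  have zy k : (t < k) || (y < k) -> y %/ p ^ k = 0.
    case/orP => [/z|yk].
      by move=> E; apply/eqP; rewrite -leqn0 -E leq_div2r //; lia.
    by rewrite divn_small //; apply: leq_trans yk (ltnW (ltn_expl k p1)).
  case: (leqP t y) => ty'.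
    rewrite (@big_cat_nat _ _ _ t.+1 1 y.+1) //= [X in _ + X]big_nat_cond.
    by rewrite [X in _ + X]big1 ?addn0 // => k /andP[/andP[tk _] _]; rewrite zy ?tk.
  rewrite (@big_cat_nat _ _ _ y.+1 1 t.+1) //=; last by lia.
  rewrite [X in _ = _ + X]big_nat_cond.
  rewrite [X in _ = _ + X]big1 ?addn0 // => k /andP[/andP[tk _] _].
  by rewrite zy ?tk ?orbT.
rewrite addn0 => e.
have : \sum_(1 <= k < t.+1) y.*2 %/ p ^ k <=
       \sum_(1 <= k < t.+1) (1 + (y %/ p ^ k).*2).
  apply: leq_sum => k _; rewrite -addnn divnD ?expn_gt0 ?prime_gt0 //.
  by rewrite addnn addnC leq_add2r leq_b1.
rewrite -e big_split /= sum_nat_const_nat muln1 subn1 /=.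
rewrite [in leqRHS](eq_bigr (fun k => 2 * (y %/ p ^ k))) => [|k _]; last by rewrite mul2n.
by rewrite -big_distrr /= mul2n leq_add2r.
Qed.

Lemma central_bin_le_exp (y : nat) : 0 < y ->
  'C(y.*2, y) <= y.*2 ^ prime_pi y.*2.
Proof.
move=> y0; have b0 : 0 < 'C(y.*2, y) by rewrite bin_gt0; lia.
rewrite [leqLHS]prod_prime_decomp // prime_decompE big_map /=.
apply: leq_trans (_ : y.*2 ^ size (primes 'C(y.*2, y)) <= _).
  apply: prod_le_exp => p; rewrite mem_primes => /andP[pp _].
  exact: logn_central_bin.
rewrite leq_pexp2l //; first by lia.
apply: uniq_leq_size; first exact: primes_uniq.
move=> p; rewrite mem_primes mem_primes_in => /and3P[pp _ pd]; rewrite pp /= ltnS.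
rewrite leqNgt; apply/negP => yp; have := prime_ndvd_fact pp yp.
by rewrite -(@bin_fact y.*2 y) ?dvdn_mulr //; lia.
Qed.

(** Take y = 2^k in 2^y <= C(2y, y) <= (2y)^([prime_pi] (2y)) and compare exponents of 2. *)
Lemma prime_pi_exp2_ge (k : nat) : 2 ^ k <= k.+1 * prime_pi (2 ^ k.+1).
Proof.
have k0 : 0 < 2 ^ k by rewrite expn_gt0.
rewrite -(@leq_exp2l 2) // expnM; apply: leq_trans (central_bin_ge _) _.
by have := central_bin_le_exp k0; rewrite -mul2n -expnS.
Qed.

(** * Comparing two windows with equal trees *)

(** The tree of a prime is a root with one leaf. So y has a single prime divisor q, whose exponent
    has no prime divisor and is thus 0 or 1; it is not 0 because q divides y. *)
Lemma tree_of_prime (p y : nat) : prime p -> tree_of y = tree_of p -> prime y.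
Proof.
move=> pp; rewrite tree_ofE [tree_of p]tree_ofE (primes_prime pp) /=.
have -> : logn p p = 1 by rewrite -{2}(expn1 p) pfactorK.
case E : (primes y) => [|q [|r s]] //= [].
rewrite tree_ofE [tree_of 1]tree_ofE => -[] /(congr1 size); rewrite size_map /= => /size0nil/eqP.
rewrite primes_eq0 => lq.
have : q \in primes y by rewrite E mem_head.
rewrite mem_primes => /and3P[pq y0 qy].
have lq1 : logn q y = 1.
  by have : 0 < logn q y; [rewrite logn_gt0 E mem_head | lia].
by rewrite (prod_prime_decomp y0) prime_decompE E /= big_seq1 /= lq1 expn1.
Qed.

Lemma count_primes_in (B x : nat) : 0 < x ->
  count (gtn B) (primes x) = \sum_(p <- primes_in 0 B) (p %| x).
Proof. by move=> /count_primes ->; rewrite big_filter big_mkord. Qed.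

Lemma size_primes_in (n L : nat) :
  size (primes_in n (n + L)) = \sum_(j < L) prime (n + j).
Proof.
elim: L => [|L IHL]; first by rewrite big_ord0 addn0 /primes_in /index_iota subnn.
rewrite big_ord_recr /= -IHL (@primes_in_cat n (n + L)) ?leq_addr ?leq_add2l //.
rewrite size_cat /primes_in /index_iota (_ : n + L.+1 - (n + L) = 1); last by lia.
by rewrite /=; case: prime.
Qed.

(** Compared with [1, L], the window [n, n + L) gains at most one multiple of p, the carry in adding
    n - 1 and L modulo p. For p > n the gain is bounded instead by the multiples in (L, L + n], as
    the window lies in [1, L + n]; this bound is the one that can be averaged over L. *)
Lemma count_multiples_le_carry (p n L : nat) : 0 < p -> 0 < n ->
  \sum_(j < L) (p %| n + j) <= \sum_(j < L) (p %| 1 + j) +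
    (if p <= n then 1 else \sum_(j < n) (p %| L.+1 + j)).
Proof.
move=> p0 n0; have := count_multiples n.-1 L p0.
have := count_multiples 0 L p0; rewrite prednK // div0n addn0 add0n => -> E.
case: (leqP p n) => [_|np].
  move: E; rewrite (divnD _ _ p0); set c := nat_of_bool (p <= _ %% p + _); move=> E.
  have : c <= 1 by exact: leq_b1.
  by move: E; move: (n.-1 %/ p) (L %/ p) c => q r c; lia.
rewrite addnC count_multiples //; apply: leq_trans (leq_addr (n.-1 %/ p) _) _.
by rewrite E leq_div2r //; lia.
Qed.

(* Both windows are compared through the primes below n + L: each of these has
   at least L %/ p multiples in the right window, and a prime n + j of the left
   window yields the additional prime n + j + D >= n + L in the right one. *)
Lemma primes_in_le_carry (n L D : nat) : 0 < n -> L <= D ->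
  (forall j, j < L -> tree_of (n + j + D) = tree_of (n + j)) ->
  size (primes_in n (n + L)) <=
    prime_pi n + \sum_(p <- primes_in n.+1 (n + L)) \sum_(j < n) (p %| L.+1 + j).
Proof.
move=> n0 LD per; set B := n + L.
have left_sum : \sum_(j < L) size (primes (n + j)) =
    \sum_(p <- primes_in 0 B) \sum_(j < L) (p %| n + j).
  rewrite exchange_big; apply: eq_bigr => j _.
  rewrite -count_primes_in ?addn_gt0 ?n0 //; apply/esym/eqP; rewrite -all_count.
  apply/allP => p; rewrite mem_primes => /and3P[_ _ /dvdn_leq].
  by rewrite addn_gt0 n0 => /(_ isT) /=; have := ltn_ord j; rewrite /B; lia.
have right_sum : \sum_(p <- primes_in 0 B) \sum_(j < L) (p %| 1 + j) +
    \sum_(j < L) prime (n + j) <= \sum_(j < L) size (primes (n + j)).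
  apply: leq_trans (_ : \sum_(j < L) (count (gtn B) (primes (n + j + D)) +
      prime (n + j)) <= _); last first.
    apply: leq_sum => j _; rewrite -(tree_of_omega (per _ (ltn_ord j))).
    rewrite -(count_predC (gtn B) (primes _)) leq_add2l.
    case pj : (prime _) => //; have pD := tree_of_prime pj (per _ (ltn_ord j)).
    by rewrite (primes_prime pD) /= /B; lia.
  rewrite big_split /= leq_add2r.
  under [leqRHS]eq_bigr => j _ do rewrite count_primes_in ?addn_gt0 ?n0 //.
  rewrite [leqRHS]exchange_big big_seq [leqRHS]big_seq; apply: leq_sum => p.
  rewrite mem_primes_in => /andP[/prime_gt0 p0 _].
  have := count_multiples_le (n + D).-1 L p0.
  rewrite prednK ?addn_gt0 ?n0 // => /leq_trans; apply.
  by rewrite leq_eqVlt; apply/orP; left; apply/eqP/eq_bigr => j _; rewrite addnAC.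
rewrite size_primes_in -(leq_add2l (\sum_(p <- primes_in 0 B) \sum_(j < L) (p %| 1 + j))).
apply: leq_trans right_sum _; rewrite left_sum.
apply: leq_trans (_ : \sum_(p <- primes_in 0 B) (\sum_(j < L) (p %| 1 + j) +
    (if p <= n then 1 else \sum_(j < n) (p %| L.+1 + j))) <= _).
  rewrite big_seq [leqRHS]big_seq; apply: leq_sum => p.
  by rewrite mem_primes_in => /andP[/prime_gt0 p0 _]; apply: count_multiples_le_carry.
rewrite big_split /= leq_add2l.
(* For L = 0 the range below B = n stops short of n + 1, so it cannot be split there. *)
case: (posnP L) => [L0|L0].
  rewrite big_seq; apply: leq_trans (leq_addr _ _).
  apply: leq_trans (_ : \sum_(p <- primes_in 0 B) 1 <= _).
    rewrite [leqRHS]big_seq; apply: leq_sum => p; rewrite mem_primes_in /B L0 addn0.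
    by move=> /and3P[_ _ /ltnW ->].
  rewrite sum1_size /prime_pi (@primes_in_cat 0 B n.+1) ?size_cat ?leq_addr //.
  by rewrite /B; lia.
rewrite (@primes_in_cat 0 n.+1 B) // /B; last by lia.
rewrite big_cat /= leq_add //.
  rewrite big_seq /prime_pi -sum1_size [leqRHS]big_seq; apply: leq_sum => p.
  by rewrite mem_primes_in ltnS => /and3P[_ _ ->].
rewrite big_seq [leqRHS]big_seq; apply: leq_sum => p.
by rewrite mem_primes_in => /and3P[_ np _]; rewrite [p <= n]leqNgt np.
Qed.

(** * Averaging the carries over windows *)

Lemma sum_count_multiples (p n I : nat) : 0 < p ->
  \sum_(i < I) \sum_(j < n) (p %| (i * n).+1 + j) = (I * n) %/ p.
Proof.
move=> p0; elim: I => [|I IHI]; first by rewrite big_ord0 div0n.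
by rewrite big_ord_recr /= IHI addnC count_multiples // mulSn addnC.
Qed.

(** Dyadic blocks: (n 2^j, n 2^(j+1)] holds at most 2 n 2^j / [trunc_log 2 n] primes, each
    contributing at most 2^(b-j), so every block costs the same 2 n 2^b / [trunc_log 2 n]. *)
Lemma sum_primes_in_div_le (n b j : nat) : 0 < n -> j <= b ->
  trunc_log 2 n * \sum_(p <- primes_in n.+1 (n * 2 ^ j).+1) (n * 2 ^ b) %/ p <=
    2 * (n * 2 ^ b) * j.
Proof.
move=> n0; elim: j => [|j IHj] jb.
  by rewrite muln1 /primes_in /index_iota subnn big_nil !muln0.
have y0 : 0 < n * 2 ^ j by rewrite muln_gt0 n0 expn_gt0.
have dbl : n * 2 ^ j.+1 = (n * 2 ^ j).*2 by rewrite expnS; lia.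
rewrite (@primes_in_cat _ (n * 2 ^ j).+1); first last.
- by rewrite dbl; lia.
- by rewrite ltnS leq_pmulr // expn_gt0.
rewrite big_cat /= mulnDr mulnS [leqRHS]addnC leq_add ?IHj //; first exact: ltnW.
rewrite dbl; set s := primes_in _ _.
have le : \sum_(p <- s) (n * 2 ^ b) %/ p <= size s * 2 ^ (b - j).
  rewrite -sum1_size big_distrl /= big_seq [leqRHS]big_seq; apply: leq_sum => p.
  rewrite mem_primes_in => /and3P[_ yp _]; rewrite mul1n.
  apply: leq_trans (leq_div2l _ y0 (ltnW yp)) _.
  rewrite -[in n * 2 ^ b](subnKC (ltnW jb)) expnD mulnA mulKn //.
have := primes_in_double_le y0; rewrite -/s => cnt.
have ll : trunc_log 2 n <= trunc_log 2 (n * 2 ^ j).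
  by rewrite leq_trunc_log // leq_pmulr // expn_gt0.
have eb : n * 2 ^ b = n * 2 ^ j * 2 ^ (b - j) by rewrite -mulnA -expnD subnKC // ltnW.
move: le cnt ll; rewrite eb; move: (\sum_(p <- s) _) (trunc_log 2 n) (trunc_log _ _) (size s).
move: (n * 2 ^ j) (2 ^ (b - j)) => y e A l l' c H1 H2 H3.
apply: leq_trans (leq_mul (leqnn l) H1) _; rewrite !mulnA leq_mul2r; apply/orP; right.
by apply: leq_trans (leq_mul H3 (leqnn c)) _; lia.
Qed.

(* Averaging over windows of length i * n: the intervals (i * n, (i + 1) * n]
   are disjoint, so together they see each prime p > n only X %/ p times. *)
Lemma exists_few_carries (n b : nat) : 0 < n ->
  exists2 i, 2 ^ b <= i < 2 ^ b.+1 &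
    trunc_log 2 n * (\sum_(p <- primes_in n.+1 (n + i * n))
      \sum_(j < n) (p %| (i * n).+1 + j)) <= 4 * n * b.+1.
Proof.
move=> n0; apply: contrapT => no.
(* The range of p is enlarged to one that does not depend on i, so that the sums over i and p can be
   exchanged. *)
pose E i := \sum_(p <- primes_in n.+1 (n * 2 ^ b.+1).+1)
  \sum_(j < n) (p %| (i * n).+1 + j).
have big_E i : 2 ^ b <= i < 2 ^ b.+1 -> 4 * n * b.+1 < trunc_log 2 n * E i.
  move=> ib; rewrite ltnNge; apply/negP => le; apply: no; exists i => //.
  apply: leq_trans le; rewrite leq_mul2l; apply/orP; right.
  rewrite /E (@primes_in_cat n.+1 (n + i * n) (n * 2 ^ b.+1).+1).
  - by rewrite big_cat leq_addr.
  - by have := expn_gt0 2 b; nia.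
  - by rewrite -mulSn mulnC leqW // leq_mul2l; case/andP: ib => _ ->; rewrite orbT.
have sum_E : \sum_(2 ^ b <= i < 2 ^ b.+1) E i <=
    \sum_(p <- primes_in n.+1 (n * 2 ^ b.+1).+1) (n * 2 ^ b.+1) %/ p.
  apply: leq_trans (_ : \sum_(0 <= i < 2 ^ b.+1) E i <= _).
    by rewrite [leqRHS](@big_cat_nat _ _ _ (2 ^ b)) ?leq_addl //= leq_exp2l.
  rewrite big_mkord exchange_big big_seq [leqRHS]big_seq; apply: leq_sum => p.
  rewrite mem_primes_in => /andP[/prime_gt0 p0 _].
  by rewrite sum_count_multiples // mulnC.
have := sum_primes_in_div_le n0 (leqnn b.+1).
have := leq_mul (leqnn (trunc_log 2 n)) sum_E.
move=> /leq_trans/[apply]; apply/negP; rewrite -ltnNge big_distrr /=.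
(* There are 2^b indices i, and 2^b * 4 n (b+1) is exactly the total bound 2 (n 2^(b+1)) (b+1). *)
apply: leq_trans (_ : \sum_(2 ^ b <= i < 2 ^ b.+1) (4 * n * b.+1).+1 <= _); last first.
  by rewrite big_nat [leqRHS]big_nat; apply: leq_sum => i; apply: big_E.
rewrite sum_nat_const_nat expnS; have := expn_gt0 2 b => /=.
move: (2 ^ b) => e e0; rewrite (_ : 2 * e - e = e); nia.
Qed.

(** * Periods of [tree_of] on an interval *)

Lemma tree_of_period_mul (n N d k : nat) :
  (forall x, n <= x <= N -> tree_of (x + d) = tree_of x) ->
  forall x, n <= x -> x + k * d <= N -> tree_of (x + k.+1 * d) = tree_of x.
Proof.
move=> per; elim: k => [|k IHk] x nx xN; first by rewrite mul1n per //; lia.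
by rewrite mulSnr addnA per ?IHk //; lia.
Qed.

(** D is the least multiple of d exceeding L. The last shift by d starts at n + j + (L %/ d) d <= n
    + 2L, so d may be arbitrarily large. *)
Lemma tree_of_long_period (n L d : nat) : 0 < d ->
  (forall x, n <= x <= n + L.*2 -> tree_of (x + d) = tree_of x) ->
  exists2 D, L <= D & forall j, j < L -> tree_of (n + j + D) = tree_of (n + j).
Proof.
move=> d0 per; exists ((L %/ d).+1 * d); first by rewrite ltnW // ltn_ceil.
move=> j jL; apply: (tree_of_period_mul per); first exact: leq_addr.
by have := leq_divM L d; lia.
Qed.

(** The period is |m - n|. The offset used is x - m or x - n, which is at most x, so x <= K suffices
    in both cases. *)
Lemma occurs_at_period (n K m : nat) : 0 < m -> m != n -> occurs_at n K m ->
  exists2 d, 0 < d &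
    forall x, n <= x -> x <= K -> tree_of (x + d) = tree_of x.
Proof.
move=> m0; rewrite neq_ltn => /orP[mn|nm] occ.
  exists (n - m) => [|x nx xK]; first by lia.
  have := occ (x - m); rewrite subnKC; last by lia.
  by move=> ->; [congr tree_of | ]; lia.
exists (m - n) => [|x nx xK]; first by lia.
have := occ (x - n); rewrite subnKC //.
by move=> <-; [congr tree_of | ]; lia.
Qed.

(** * The contradiction for large n *)

(** Fixes how large n must be: 14 is the least a satisfying the inequality. *)
Lemma mul_ltn_exp2 (a : nat) : 14 <= a -> 128 * (24 + 4 * a) < 2 ^ a.
Proof.
move=> /subnKC <-; elim: (a - 14) => [|k IHk]; first by [].
by rewrite addnS expnS; lia.
Qed.

(** Let Q count the primes up to 2^(l+a-3) <= L. The carry bound gives l Q <= (24 + 4a) n, while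
    Chebyshev's lower bound and a < l give 2^(l+a-4) <= 2 l Q. As n < 2^(l+1), this forces 2^(a-4)
    <= 4 (24 + 4a). *)
Lemma no_long_period (n L D i a : nat) : 0 < n ->
  a = trunc_log 2 (trunc_log 2 n) -> 14 <= a ->
  L = i * n -> 2 ^ (a - 3) <= i -> L <= D ->
  trunc_log 2 n * (\sum_(p <- primes_in n.+1 (n + L))
      \sum_(j < n) (p %| L.+1 + j)) <= 4 * n * a ->
  (forall j, j < L -> tree_of (n + j + D) = tree_of (n + j)) -> False.
Proof.
move=> n0 aE a14 LE ia LD few per.
have := primes_in_le_carry n0 LD per; move: few.
set E := \sum_(p <- _) _; set l := trunc_log 2 n in aE * => few le_carry.
have l0 : 0 < l by move: a14; rewrite aE; case: (l).
have /andP[ln nl] := trunc_log_bounds (isT : 1 < 2) n0; rewrite -/l in ln nl.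
have al : a < l.
  by rewrite aE; apply: leq_trans (trunc_logP (isT : 1 < 2) l0); apply: ltn_expl.
(* The upper bound is applied at 2^(l+1), which lies between n and 2n. *)
have pi_n : l * prime_pi n <= 12 * n.
  have := prime_pi_exp2_le l.+1; have := leq_prime_pi (ltnW nl).
  by move: nl ln; rewrite expnS; nia.
(* One [prime_pi n] covers the primes below n; the other, with E, covers the window [n, n + L). *)
have pi_le : prime_pi (2 ^ (l + (a - 4)).+1) <= prime_pi n + prime_pi n + E.
  apply: leq_trans (_ : prime_pi (n + L).-1 <= _).
    apply: leq_prime_pi; apply: leq_trans (_ : L <= _); last by lia.
    rewrite LE (_ : (l + (a - 4)).+1 = a - 3 + l); last by lia.
    by rewrite expnD leq_mul.
  have -> : prime_pi (n + L).-1 = size (primes_in 0 n) + size (primes_in n (n + L)).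
    by rewrite /prime_pi prednK -?size_cat -?primes_in_cat //; lia.
  rewrite -addnA leq_add // /prime_pi (@primes_in_cat 0 n n.+1) //.
  by rewrite size_cat leq_addr.
have pi_ge := prime_pi_exp2_ge (l + (a - 4)).
have := mul_ltn_exp2 a14; move: pi_ge; rewrite expnD.
move: nl; rewrite expnS.
have -> : 2 ^ a = 16 * 2 ^ (a - 4).
  by rewrite -[16]/(2 ^ 4) -expnD; congr (_ ^ _); lia.
move: pi_le few pi_n ln; move: (prime_pi _) (prime_pi n) (2 ^ l) (2 ^ (a - 4)).
move=> Q q u v pi_le few pi_n ln nl pi_ge.
apply/negP; rewrite -leqNgt.
have h1 : l * Q <= n * (24 + 4 * a) by nia.
have h2 : u * v <= l.*2 * Q by apply: leq_trans pi_ge _; rewrite leq_mul2r; lia.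
have h3 : u * v <= 2 * (n * (24 + 4 * a)) by nia.
have h4 : n * v <= n * (4 * (24 + 4 * a)) by nia.
move: h4; rewrite leq_mul2l; lia.
Qed.

Lemma kappa_plus_le (n : nat) : 14 <= trunc_log 2 (trunc_log 2 n) ->
  kappa_plus n <= n * trunc_log 2 n.
Proof.
set a := trunc_log 2 _ => a14; have n0 : 0 < n by case: n @a a14.
have l0 : 0 < trunc_log 2 n by move: a14; rewrite /a; case: (trunc_log 2 n).
rewrite /kappa_plus; case: ex_minnP => K _; apply.
apply/asboolP => m m0 occ; apply/eqP/negPn/negP => mn.
have [d d0 per] := occurs_at_period m0 mn occ.
(* Since i < 2^(a-2), the interval needed ends at n + 2 i n < n 2^(a-1), which is below n *
   [trunc_log 2 n]. *)
have [i /andP[i_ge i_lt] few] := exists_few_carries (a - 3) n0.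
have al : 2 ^ a <= trunc_log 2 n by apply: trunc_logP.
have [x|D LD perD] := @tree_of_long_period n (i * n) d d0.
  move=> /andP[nx xL]; apply: per => //; apply: leq_trans xL _.
  move: i_lt al; rewrite (_ : a = (a - 3).+1.+2); last by lia.
  by rewrite subSS subSS subn1 /= !expnS; nia.
apply: (no_long_period n0 (erefl a) a14 (erefl (i * n)) i_ge LD _ perD).
by apply: leq_trans few _; rewrite leq_mul2l; apply/orP; right; lia.
Qed.

Lemma trunc_log2_iter_large (k : nat) :
  exists N, forall n, N <= n -> k <= trunc_log 2 (trunc_log 2 n).
Proof. by exists (2 ^ (2 ^ k)) => n Nn; do 2 apply: trunc_log_max => //. Qed.

(** * Passage to the natural logarithm *)

Import Order.TTheory GRing.Theory Num.Theory.
Import numFieldNormedType.Exports.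
Local Open Scope classical_set_scope.
Local Open Scope ring_scope.

(** Rests on ln 2 >= 1/2, which is ln (1 + x) <= x at x = -1/2. The factor 2 is the one in the final
    bound. *)
Lemma trunc_log2_le_ln (R : realType) (n : nat) : (0 < n)%N ->
  (trunc_log 2 n)%:R <= 2 * ln (n%:R : R).
Proof.
move=> n0; have half_le : 2^-1 <= ln (2 : R).
  have := @le_ln1Dx R (- 2^-1); rewrite (_ : 1 + - 2^-1 = 2^-1); last by lra.
  by rewrite lnV ?posrE ?ltr0n // lerN2; apply; lra.
have : ln ((2 ^ trunc_log 2 n)%:R : R) <= ln (n%:R : R).
  by rewrite ler_ln ?posrE ?ltr0n ?expn_gt0 // ler_nat trunc_logP.
rewrite natrX lnXn ?ltr0n // -[_ *+ trunc_log 2 n]mulr_natl.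
by have := ler_wpM2l (ler0n R (trunc_log 2 n)) half_le; lra.
Qed.

Theorem theorem2 (R : realType) :
  exists eps : nat -> R,
    eps @ \oo --> (0 : R) /\
    forall n : nat, (2 <= n)%N ->
      (kappa_plus n)%:R <= 2 * n%:R * ln (n%:R : R) * (1 + eps n).
Proof.
pose large n := (14 <= trunc_log 2 (trunc_log 2 n))%N.
(* For the finitely many small n, the value is the ratio of [kappa_plus n] to 2 n ln n, which makes
   the bound hold trivially. *)
exists (fun n => if large n then 0
  else (kappa_plus n)%:R / (2 * n%:R * ln (n%:R : R))).
split=> [|n n2].
  have [N NP] := trunc_log2_iter_large 14.
  apply: cvg_near_cst; exists N => // n /= Nn.
  by rewrite /large NP.
have n0 : (0 < n)%N by exact: ltnW.
have pos : 0 < 2 * n%:R * ln (n%:R : R).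
  by rewrite !mulr_gt0 ?ltr0n ?ln_gt0 ?ltr1n.
case: ifP => [n_large|_].
  rewrite addr0 mulr1; apply: le_trans (_ : (n * trunc_log 2 n)%:R <= _).
    by rewrite ler_nat kappa_plus_le.
  rewrite natrM mulrAC [leRHS]mulrC ler_wpM2l ?ler0n //.
  exact: trunc_log2_le_ln.
by rewrite mulrDr mulr1 mulrCA divff ?gt_eqF // mulr1 lerDr ltW.
Qed.
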